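(* There exist a group $G$, finite generating sets $\mathcal S\subset\tilde{\mathcal S}$ of $G$, and an infinite geodesic $\gamma$ in $X:=\mathrm{Cay}(G,\mathcal S)$ labelled by the powers of a single generator, with the following properties: - $\gamma$ is not strongly contracting in $X$; - the image $\tilde\gamma$ of $\gamma$ in $\tilde X:=\mathrm{Cay}(G,\tilde{\mathcal S})$, obtained from the inclusion $\mathcal S\subset\tilde{\mathcal S}$, is an infinite strongly contracting geodesic in $\tilde X$.
   Context: Cayley graphs carry the graph metric. For a closed subspace $Y$ of a geodesic metric space, closest point projection is $\pi(x)=\{y\in Y:d(x,y)=d(x,Y)\}$. $Y$ is strongly contracting if there is a constant $C$ such that, for all $x,x'$, $d(x,x')\le d(x,Y)$ implies $\mathrm{diam}(\pi(x)\cup\pi(x'))\le C$. *)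

(* Defs.v *)
From Stdlib Require Import Reals Lra ZArith List ClassicalEpsilon.
Open Scope R_scope.

Record group := Group {
  carrier :> Type;
  gmul : carrier -> carrier -> carrier;
  ginv : carrier -> carrier;
  gone : carrier;
  gmulA : forall x y z, gmul x (gmul y z) = gmul (gmul x y) z;
  gmul1 : forall x, gmul gone x = x;
  gmulV : forall x, gmul (ginv x) x = gone }.
Arguments gmul {g} _ _.
Arguments ginv {g} _.
Arguments gone {g}.

Definition npow {G : group} (x : G) (n : nat) : G :=
  Nat.iter n (fun y => gmul y x) gone.
Definition zpow {G : group} (x : G) (z : Z) : G :=
  match z with
  | Z0 => gone
  | Zpos p => npow x (Pos.to_nat p)
  | Zneg p => ginv (npow x (Pos.to_nat p))
  end.

Inductive wlen {G : group} (A : list G) : nat -> G -> Prop :=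
| wlen0 : wlen A 0 gone
| wlenR : forall n x s, In s A -> wlen A n x -> wlen A (Datatypes.S n) (gmul x s)
| wlenRV : forall n x s, In s A -> wlen A n x -> wlen A (Datatypes.S n) (gmul x (ginv s)).

Definition generates {G : group} (A : list G) : Prop :=
  forall g : G, exists n, wlen A n g.

(** Word metric d_A(g,h) = |g^{-1} h|_A (meaningful when A generates G). *)
Definition wdist {G : group} (A : list G) (g h : G) : nat :=
  epsilon (inhabits 0%nat)
    (fun n => wlen A n (gmul (ginv g) h) /\
              forall m, wlen A m (gmul (ginv g) h) -> (n <= m)%nat).

(** Points of the geometric realisation of Cay(G,A): the edges are
    {g, g s} for s in A (labelled s), each isometric to [0,1].
    [Vx g] is the vertex g; [Ed g s t] (s in A, 0<t<1) is the point at
    distance t from g on the edge from g to g s. *)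
Inductive cpt (G : group) : Type :=
| Vx (g : G)
| Ed (g s : G) (t : R).
Arguments Vx {G} g.
Arguments Ed {G} g s t.

Definition valid {G : group} (A : list G) (p : cpt G) : Prop :=
  match p with
  | Vx _ => True
  | Ed _ s t => In s A /\ 0 < t < 1
  end.

Definition ends {G : group} (p : cpt G) : list (G * R) :=
  match p with
  | Vx g => (g, 0) :: nil
  | Ed g s t => (g, t) :: (gmul g s, 1 - t) :: nil
  end.

Definition listmin (l : list R) : R :=
  match l with nil => 0 | x :: l' => fold_right Rmin x l' end.

Definition through_ends {G : group} (A : list G) (p q : cpt G) : R :=
  listmin (flat_map (fun u =>
     map (fun v => snd u + INR (wdist A (fst u) (fst v)) + snd v) (ends q))
     (ends p)).

Definition gdist {G : group} (A : list G) (p q : cpt G) : R :=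
  let b := through_ends A p q in
  match p, q with
  | Ed g s t, Ed h s' t' =>
      if excluded_middle_informative (g = h /\ s = s')
      then Rmin b (Rabs (t - t'))
      else if excluded_middle_informative
                (h = gmul g s /\ s' = s /\ gmul h s' = g /\ g <> h)
           then Rmin b (Rabs (t - (1 - t')))  (* same edge, opposite orientation *)
           else b
  | _, _ => b
  end.

Definition gamma {G : group} (g0 a : G) (t : R) : cpt G :=
  let n := Int_part t in
  let r := frac_part t in
  if Req_EM_T r 0 then Vx (gmul g0 (zpow a n))
  else Ed (gmul g0 (zpow a n)) a r.

Definition image {G : group} (c : R -> cpt G) : cpt G -> Prop :=
  fun p => exists t, p = c t.

Definition is_geodesic {G : group} (A : list G) (c : R -> cpt G) : Prop :=
  (forall t, valid A (c t)) /\
  forall s t, gdist A (c s) (c t) = Rabs (s - t).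

Definition cproj {G : group} (A : list G) (Y : cpt G -> Prop) (x y : cpt G) : Prop :=
  Y y /\ forall y', Y y' -> gdist A x y <= gdist A x y'.

Definition strongly_contracting {G : group} (A : list G) (Y : cpt G -> Prop) : Prop :=
  exists C : R, forall x x' : cpt G, valid A x -> valid A x' ->
    (forall y, Y y -> gdist A x x' <= gdist A x y) ->
    forall p q, (cproj A Y x p \/ cproj A Y x' p) ->
                (cproj A Y x q \/ cproj A Y x' q) ->
                gdist A p q <= C.

(* Main.v *)
(** Let [G = <a, b, c | bc = cb, a b a^-1 = c>], an HNN extension of [Z^2] with stable
    letter [a].

    With respect to [S = {a, b, b^2 c^-1}] every generator moves the abelianization
    [Z^2] by a unit vector, so the closest point to [a^n b^r] on the axis of [a] is [a^n],
    at distance [r]. Since [b^2R = (b^2 c^-1)^R c^R] and [c^R a = a b^R], the point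
    [b^L] with [L = 2^k k] is at distance at most [L] from [a^k b^k], whose projection is
    [k] away from that of [b^L].

    Adding [c], [b^2] and [c^2] destroys this shortcut. In the Bass-Serre tree, a path
    crossing the axis at [a^j] passes from some [a^j b^y] to some [a^j c^z], and killing the
    exponent [y] of [a^j b a^-j] already takes as long as going to [a^j], because every
    generator changes that exponent by at most two and [b^2] is a generator. Hence a
    path no longer than the distance to the axis has bounded projection. *)

Require Import Defs.
From Stdlib Require Import Reals List.
From Stdlib Require Import Lra Lia ZArith Bool ClassicalEpsilon.

(** * Groups and word metrics *)

Section Groups.
Context {G : group}.
Implicit Types x y : G.

Lemma gmulVr x : gmul x (ginv x) = gone.
Proof.
  rewrite <- (gmul1 _ (gmul x (ginv x))).
  rewrite <- (gmulV _ (ginv x)) at 1.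
  rewrite <- gmulA, (gmulA _ (ginv x)), gmulV, gmul1. apply gmulV.
Qed.

Lemma gmul1r x : gmul x gone = x.
Proof. rewrite <- (gmulV _ x), gmulA, gmulVr. apply gmul1. Qed.

Lemma gmulK x y : gmul (gmul x y) (ginv y) = x.
Proof. now rewrite <- gmulA, gmulVr, gmul1r. Qed.

Lemma gmulKV x y : gmul (gmul x (ginv y)) y = x.
Proof. now rewrite <- gmulA, gmulV, gmul1r. Qed.

Lemma gmulVK x y : gmul (ginv x) (gmul x y) = y.
Proof. now rewrite gmulA, gmulV, gmul1. Qed.

Lemma gmulKl x y : gmul x (gmul (ginv x) y) = y.
Proof. now rewrite gmulA, gmulVr, gmul1. Qed.

Lemma ginv_unique x y : gmul x y = gone -> ginv y = x.
Proof. intros H. now rewrite <- (gmulK x y), H, gmul1. Qed.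

Lemma ginv1 : ginv gone = gone :> G.
Proof. apply ginv_unique, gmul1. Qed.

Lemma ginvM x y : ginv (gmul x y) = gmul (ginv y) (ginv x).
Proof.
  apply ginv_unique. now rewrite <- gmulA, gmulVK, gmulV.
Qed.

Lemma npow_comm x n : gmul x (npow x n) = gmul (npow x n) x.
Proof.
  induction n as [|n IH]; simpl.
  - now rewrite gmul1, gmul1r.
  - now rewrite gmulA, IH.
Qed.

Lemma ginv_npowS x n : ginv (npow x (S n)) = gmul (ginv (npow x n)) (ginv x).
Proof. change (npow x (S n)) with (gmul (npow x n) x). now rewrite <- npow_comm, ginvM. Qed.

Lemma zpow_of_nat x n : zpow x (Z.of_nat n) = npow x n.
Proof. destruct n; [easy|]. simpl zpow. now rewrite SuccNat2Pos.id_succ. Qed.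

Lemma zpow_opp_of_nat x n : zpow x (- Z.of_nat n) = ginv (npow x n).
Proof.
  destruct n; [symmetry; apply ginv1|]. simpl zpow. now rewrite SuccNat2Pos.id_succ.
Qed.

Lemma zpow_succ x z : zpow x (z + 1) = gmul (zpow x z) x.
Proof.
  destruct (Z_lt_le_dec z 0) as [H|H].
  - replace z with (- Z.of_nat (S (Z.to_nat (-z-1))))%Z by lia.
    replace (- Z.of_nat (S (Z.to_nat (-z-1))) + 1)%Z with (- Z.of_nat (Z.to_nat (-z-1)))%Z by lia.
    now rewrite !zpow_opp_of_nat, ginv_npowS, gmulKV.
  - replace z with (Z.of_nat (Z.to_nat z)) by lia.
    replace (Z.of_nat (Z.to_nat z) + 1)%Z with (Z.of_nat (S (Z.to_nat z))) by lia.
    now rewrite !zpow_of_nat.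
Qed.

Lemma zpow_pred x z : zpow x (z - 1) = gmul (zpow x z) (ginv x).
Proof.
  replace z with (z - 1 + 1)%Z at 2 by lia. now rewrite zpow_succ, gmulK.
Qed.

Local Open Scope Z_scope.

Lemma zpow_add x m n : gmul (zpow x m) (zpow x n) = zpow x (m + n).
Proof.
  assert (Hk : forall k, gmul (zpow x m) (zpow x (Z.of_nat k)) = zpow x (m + Z.of_nat k) /\
                         gmul (zpow x m) (zpow x (- Z.of_nat k)) = zpow x (m - Z.of_nat k)).
  { induction k as [|k [IH1 IH2]].
    - simpl. now rewrite Z.add_0_r, Z.sub_0_r, gmul1r.
    - replace (Z.of_nat (S k)) with (Z.of_nat k + 1) by lia.
      replace (- (Z.of_nat k + 1)) with (- Z.of_nat k - 1) by lia.
      rewrite zpow_succ, zpow_pred, !gmulA, IH1, IH2, <- zpow_succ, <- zpow_pred.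
      split; f_equal; lia. }
  destruct (Z_lt_le_dec n 0).
  - replace n with (- Z.of_nat (Z.to_nat (- n))) by lia. apply Hk.
  - replace n with (Z.of_nat (Z.to_nat n)) by lia. apply Hk.
Qed.

Local Close Scope Z_scope.

(** * Word length and word distance *)

Lemma wlen_app (A : list G) m n x y :
  wlen A m x -> wlen A n y -> wlen A (m + n) (gmul x y).
Proof.
  intros Hx Hy; induction Hy as [|n y s Hs _ IH|n y s Hs _ IH].
  - now rewrite gmul1r, Nat.add_0_r.
  - rewrite gmulA, Nat.add_succ_r. now apply wlenR.
  - rewrite gmulA, Nat.add_succ_r. now apply wlenRV.
Qed.

Lemma wlen_gen (A : list G) s : In s A -> wlen A 1 s.
Proof. intros H. rewrite <- (gmul1 _ s). apply wlenR; [easy|constructor]. Qed.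

Lemma wlen_ginv_gen (A : list G) s : In s A -> wlen A 1 (ginv s).
Proof. intros H. rewrite <- (gmul1 _ (ginv s)). apply wlenRV; [easy|constructor]. Qed.

Lemma wlen_incl (A B : list G) n x : incl A B -> wlen A n x -> wlen B n x.
Proof.
  intros HI H; induction H; [constructor|apply wlenR|apply wlenRV]; auto.
Qed.

Lemma wdist_min (A : list G) x y n :
  wlen A n (gmul (ginv x) y) ->
  wlen A (wdist A x y) (gmul (ginv x) y) /\ (wdist A x y <= n)%nat.
Proof.
  intros H. unfold wdist.
  assert (E : exists n, wlen A n (gmul (ginv x) y) /\
              forall m, wlen A m (gmul (ginv x) y) -> (n <= m)%nat).
  { destruct (dec_inh_nat_subset_has_unique_least_element
                (fun n => wlen A n (gmul (ginv x) y))) as [k [Hk _]].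
    - intros k. apply classic.
    - now exists n.
    - now exists k. }
  apply (epsilon_spec (inhabits 0%nat)) in E. split; [apply E|]. now apply E.
Qed.

Lemma wdist_le (A : list G) x y n : wlen A n (gmul (ginv x) y) -> (wdist A x y <= n)%nat.
Proof. apply wdist_min. Qed.

Lemma wdist_wlen (A : list G) x y : generates A -> wlen A (wdist A x y) (gmul (ginv x) y).
Proof. intros H. destruct (H (gmul (ginv x) y)) as [n Hn]. now apply (wdist_min _ _ _ n). Qed.

End Groups.

(** * Distances between points of the Cayley graph *)

Lemma fold_right_Rmin_le l x y : (y = x \/ In y l) -> fold_right Rmin x l <= y.
Proof.
  induction l as [|z l IH]; simpl; intros H.
  - destruct H as [->|[]]. lra.
  - destruct H as [->|[->|H]].
    + eapply Rle_trans; [apply Rmin_r|]. auto.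
    + apply Rmin_l.
    + eapply Rle_trans; [apply Rmin_r|]. auto.
Qed.

Lemma fold_right_Rmin_in l x : fold_right Rmin x l = x \/ In (fold_right Rmin x l) l.
Proof.
  induction l as [|z l IH]; simpl; auto.
  destruct (Rmin_case z (fold_right Rmin x l) (fun r => r = z \/ r = fold_right Rmin x l))
    as [E|E]; auto; rewrite E; intuition.
Qed.

Lemma listmin_le l x : In x l -> listmin l <= x.
Proof.
  destruct l as [|y l]; simpl; [easy|]. intros H.
  apply fold_right_Rmin_le. intuition.
Qed.

Lemma listmin_in l : l <> nil -> In (listmin l) l.
Proof.
  destruct l as [|y l]; simpl; [easy|]. intros _.
  destruct (fold_right_Rmin_in l y); auto.
Qed.

Section CayleyGraph.
Context {G : group}.
Context (A : list G).
Implicit Types p q : cpt G.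

Lemma through_ends_le p q u r v r' :
  In (u, r) (ends p) -> In (v, r') (ends q) ->
  through_ends A p q <= r + INR (wdist A u v) + r'.
Proof.
  intros Hu Hv. apply listmin_le, in_flat_map. exists (u, r); split; [easy|].
  apply in_map_iff. now exists (v, r').
Qed.

Lemma through_ends_attained p q :
  exists u r v r', In (u, r) (ends p) /\ In (v, r') (ends q) /\
    through_ends A p q = r + INR (wdist A u v) + r'.
Proof.
  assert (H : In (through_ends A p q) (flat_map (fun u =>
     map (fun v => snd u + INR (wdist A (fst u) (fst v)) + snd v) (ends q)) (ends p))).
  { apply listmin_in. destruct p, q; discriminate. }
  apply in_flat_map in H. destruct H as [[u r] [Hu H]].
  apply in_map_iff in H. destruct H as [[v r'] [E Hv]].
  exists u, r, v, r'. simpl in E. auto.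
Qed.

Lemma gdist_le p q u r v r' :
  In (u, r) (ends p) -> In (v, r') (ends q) ->
  gdist A p q <= r + INR (wdist A u v) + r'.
Proof.
  intros Hu Hv. eapply Rle_trans; [|apply (through_ends_le p q); eassumption].
  destruct p as [g|g s t], q as [h|h s' t']; simpl; try lra.
  destruct excluded_middle_informative; [apply Rmin_l|].
  destruct excluded_middle_informative; [apply Rmin_l|lra].
Qed.

(** A minimising path may stay inside an edge only when both points lie on that edge. All that is
    needed of this case later is a common end. *)
Lemma gdist_attained p q :
  (exists u r v r', In (u, r) (ends p) /\ In (v, r') (ends q) /\
     gdist A p q = r + INR (wdist A u v) + r') \/
  (exists u r r', In (u, r) (ends p) /\ In (u, r') (ends q)).
Proof.
  destruct (through_ends_attained p q) as (u & r & v & r' & Hu & Hv & E).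
  destruct p as [g|g s t], q as [h|h s' t'];
    try (left; exists u, r, v, r'; tauto).
  unfold gdist.
  destruct excluded_middle_informative as [[-> ->]|_].
  { right. exists h, t, t'. simpl; auto. }
  destruct excluded_middle_informative as [[-> _]|_].
  { right. exists (gmul g s), (1 - t), t'. simpl; auto. }
  left; exists u, r, v, r'; tauto.
Qed.

Lemma ends_weight_bounds p u r : valid A p -> In (u, r) (ends p) -> 0 <= r <= 1.
Proof.
  destruct p as [g|g s t]; simpl; intros H.
  - intros [[= <- <-]|[]]; lra.
  - intros [[= <- <-]|[[= <- <-]|[]]]; lra.
Qed.

Lemma gdist_vertices g h : gdist A (Vx g) (Vx h) = INR (wdist A g h).
Proof. unfold gdist, through_ends; simpl. lra. Qed.

Lemma gamma_vertex (a : G) (n : Z) : gamma gone a (IZR n) = Vx (zpow a n).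
Proof.
  assert (E : Int_part (IZR n) = n).
  { unfold Int_part. rewrite <- (tech_up (IZR n) (n + 1)); rewrite ?plus_IZR; try lra. lia. }
  unfold gamma, frac_part. rewrite E, gmul1.
  destruct (Req_EM_T (IZR n - IZR n) 0) as [|H]; [easy|lra].
Qed.

Lemma gamma_cases (a : G) (t : R) : exists n r, t = IZR n + r /\
  ((r = 0 /\ gamma gone a t = Vx (zpow a n)) \/
   (0 < r < 1 /\ gamma gone a t = Ed (zpow a n) a r)).
Proof.
  exists (Int_part t), (frac_part t). split; [unfold frac_part; lra|].
  destruct (base_fp t) as [H0 H1]. unfold gamma. rewrite gmul1.
  destruct (Req_EM_T (frac_part t) 0) as [E|E]; [left|right]; split; auto; lra.
Qed.

(** Distances between points of the line are minima over paths through ends, so an isometry on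
    integer points extends to all of it. *)
Lemma gamma_is_geodesic (a : G) : In a A ->
  (forall m n, INR (wdist A (zpow a m) (zpow a n)) = Rabs (IZR m - IZR n)) ->
  is_geodesic A (gamma gone a).
Proof.
  intros Ha Hd.
  assert (Hinj : forall m n, zpow a m = zpow a n -> m = n).
  { intros m n E. apply eq_IZR. pose proof (Hd m n) as H1. pose proof (Hd n n) as H2.
    rewrite E, H2, Rminus_diag, Rabs_R0 in H1.
    destruct (Req_dec (IZR m) (IZR n)) as [|N]; [easy|].
    pose proof (Rabs_pos_lt (IZR m - IZR n)). lra. }
  split.
  - intros t. destruct (gamma_cases a t) as (n & r & _ & [[_ ->]|[Hr ->]]); simpl; auto.
  - intros s t.
    destruct (gamma_cases a s) as (m & r & -> & Hs).
    destruct (gamma_cases a t) as (n & r' & -> & Ht).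
    (* Distinct integers differ by at least one; this fixes which ends are nearest. *)
    assert (Htri : m = n \/ IZR m + 1 <= IZR n \/ IZR n + 1 <= IZR m).
    { destruct (Z.lt_trichotomy m n) as [H|[H|H]]; [right; left|now left|right; right];
      rewrite <- plus_IZR; apply IZR_le; lia. }
    destruct Hs as [[-> ->]|[Hr ->]], Ht as [[-> ->]|[Hr' ->]].
    + rewrite gdist_vertices, Hd. f_equal; lra.
    + unfold gdist, through_ends; simpl. rewrite <- !zpow_succ, !Hd, !plus_IZR.
      destruct Htri as [->|[H|H]]; unfold Rmin, Rabs;
      repeat (destruct Rle_dec || destruct Rcase_abs); lra.
    + unfold gdist, through_ends; simpl. rewrite <- !zpow_succ, !Hd, !plus_IZR.
      destruct Htri as [->|[H|H]]; unfold Rmin, Rabs;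
      repeat (destruct Rle_dec || destruct Rcase_abs); lra.
    + unfold gdist, through_ends; simpl. rewrite <- !zpow_succ, !Hd, !plus_IZR.
      destruct excluded_middle_informative as [[E _]|NE].
      * apply Hinj in E. subst n. clear Htri.
        unfold Rmin, Rabs; repeat (destruct Rle_dec || destruct Rcase_abs); lra.
      (* The same edge read backwards would require [n = m + 1] and [m = n + 1]. *)
      * destruct excluded_middle_informative as [(E1 & _ & E2 & _)|_].
        { apply Hinj in E1, E2. lia. }
        destruct Htri as [->|[H|H]]; [tauto| |]; unfold Rmin, Rabs;
        repeat (destruct Rle_dec || destruct Rcase_abs); lra.
Qed.

End CayleyGraph.

(** * The HNN extension [<a, b, c | bc = cb, a b = c a>] *)

(** The state [((e_n, t_n) :: ... :: (e_1, t_1) :: nil, (x, y))] is the normal form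
    [w_1 a^e_1 w_2 a^e_2 ... w_n a^e_n b^x c^y] of Britton's lemma, where [w_i = b^t_i]
    if [e_i = 1] (encoded by [true]) and [w_i = c^t_i] if [e_i = -1] ([false]). *)
Notation stack := (list (bool * Z)).
Definition state : Type := (stack * (Z * Z))%type.

Local Open Scope Z_scope.

(** Puts first the exponent that stays in front of [a^e]: that of [b] for [a], that of [c] for
    [a^-1]. Both signs can then be treated at once. *)
Definition swap_if_neg (e : bool) (v : Z * Z) : Z * Z := if e then v else (snd v, fst v).

Definition translate (v : Z * Z) (g : state) : state :=
  (fst g, (fst (snd g) + fst v, snd (snd g) + snd v)).

(** Encodes [b^x c^y a = b^x a b^y] and [b^x c^y a^-1 = c^y a^-1 c^x]. *)
Definition push_step (e : bool) (g : state) : state :=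
  let v := swap_if_neg e (snd g) in
  ((e, fst v) :: fst g, swap_if_neg e (snd v, 0)).

(** Right multiplication by [a] or [a^-1]. *)
Definition step (e : bool) (g : state) : state :=
  let v := swap_if_neg e (snd g) in
  match fst g with
  | (e', t) :: s =>
      if negb (eqb e e') && (fst v =? 0) then (s, swap_if_neg e (snd v, t)) else push_step e g
  | nil => push_step e g
  end.

(** Britton's condition: no subword [a^-1 c^q a] or [a b^q a^-1] remains. *)
Fixpoint reduced (s : stack) : Prop :=
  match s with
  | nil => True
  | (e, t) :: s' =>
      reduced s' /\ match s' with (e', _) :: _ => e = e' \/ t <> 0 | nil => True end
  end.

Fixpoint smul (g : state) (s : stack) : state :=
  match s with
  | nil => g
  | (e, t) :: s' => step e (translate (swap_if_neg e (t, 0)) (smul g s'))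
  end.

Definition state_mul (g h : state) : state := translate (snd h) (smul g (fst h)).

(** Right multiplication by the inverse of the word [s], last letter first; it undoes [smul]. *)
Fixpoint sdiv (g : state) (s : stack) : state :=
  match s with
  | nil => g
  | (e, t) :: s' => sdiv (translate (swap_if_neg e (- t, 0)) (step (negb e) g)) s'
  end.

Definition state_one : state := (nil, (0, 0)).

Definition state_inv (g : state) : state :=
  sdiv (translate (- fst (snd g), - snd (snd g)) state_one) (fst g).

Ltac state_eq := repeat match goal with
  | |- pair _ _ = pair _ _ => f_equal
  | |- cons _ _ = cons _ _ => f_equal
  end; try reflexivity; try lia.

Lemma translate_translate v w g : translate v (translate w g) = translate (fst w + fst v, snd w + snd v) g.
Proof. unfold translate; simpl; state_eq. Qed.

Lemma translate0 g : translate (0, 0) g = g.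
Proof. destruct g as [s [x y]]; unfold translate; simpl; state_eq. Qed.

Lemma step_cases e g :
  (exists t s, fst g = (negb e, t) :: s /\ fst (swap_if_neg e (snd g)) = 0 /\
     step e g = (s, swap_if_neg e (snd (swap_if_neg e (snd g)), t))) \/
  (step e g = push_step e g /\
   match fst g with
   | (e', t) :: _ => e = e' \/ fst (swap_if_neg e (snd g)) <> 0
   | nil => True
   end).
Proof.
  destruct g as [[|[e' t] s] v]; unfold step; simpl; auto.
  destruct (fst (swap_if_neg e v) =? 0) eqn:E; destruct e, e'; simpl; auto;
    rewrite ?Z.eqb_eq, ?Z.eqb_neq in E; auto; left; exists t, s; auto.
Qed.

(** The defining relation [c^q a = a b^q], and [b^q a^-1 = a^-1 c^q] for the other sign. *)
Lemma step_translate e q g :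
  step e (translate (swap_if_neg e (0, q)) g) = translate (swap_if_neg e (q, 0)) (step e g).
Proof.
  destruct g as [s [x y]]; destruct s as [|[[] t] s], e; unfold step, push_step, translate; simpl;
    rewrite ?Z.add_0_r; try reflexivity; destruct (_ =? 0); simpl; state_eq.
Qed.

(** If the first step cancels a letter, the second must push it back; reducedness prevents it from
    cancelling the next letter of the stack instead. *)
Lemma step_stepV e g : reduced (fst g) -> step (negb e) (step e g) = g.
Proof.
  destruct (step_cases e g) as [(t & s & E & F & ->)|[-> _]].
  - destruct g as [s0 [x y]]; simpl in E, F; subst s0; intros H; simpl in H; destruct H as [_ H].
    destruct s as [|[e' t'] s]; [destruct e; unfold step, push_step; simpl in *; now subst|].
    destruct e, e'; unfold step, push_step; simpl in *; subst;
      try (destruct H as [H|H]; [discriminate|]; apply Z.eqb_neq in H; rewrite H); easy.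
  - intros _. destruct g as [s [x y]]; destruct e; reflexivity.
Qed.

Lemma stepV_step e g : reduced (fst g) -> step e (step (negb e) g) = g.
Proof. rewrite <- (negb_involutive e) at 1. apply step_stepV. Qed.

Lemma reduced_step e g : reduced (fst g) -> reduced (fst (step e g)).
Proof.
  destruct (step_cases e g) as [(t & s & E & F & ->)|[-> H]]; intros R.
  - rewrite E in R. now destruct R.
  - split; [easy|]. fold reduced. destruct (fst g) as [|[]]; auto.
Qed.

Lemma reduced_smul g s : reduced (fst g) -> reduced (fst (smul g s)).
Proof.
  intros R; induction s as [|[e t] s IH]; simpl; auto.
  apply reduced_step. exact IH.
Qed.

Lemma reduced_sdiv s : forall g, reduced (fst g) -> reduced (fst (sdiv g s)).
Proof.
  induction s as [|[e t] s IH]; simpl; auto.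
  intros g R. apply IH. now apply reduced_step.
Qed.

Lemma state_mul_translate v g h : state_mul g (translate v h) = translate v (state_mul g h).
Proof. unfold state_mul. now rewrite translate_translate. Qed.

(** The heart of associativity. When [h] ends in a cancelling letter, the commuting power is moved
    past [a^e], and the two opposite steps on the product undo each other. *)
Lemma state_mul_step e g h :
  reduced (fst g) -> state_mul g (step e h) = step e (state_mul g h).
Proof.
  intros R. destruct (step_cases e h) as [(t & s & E & F & ->)|[-> _]].
  - unfold state_mul at 2. rewrite E.
    replace (snd h) with (swap_if_neg e (0, snd (swap_if_neg e (snd h))))
      by (destruct h as [? []], e; simpl in *; now subst).
    rewrite step_translate. simpl.
    rewrite stepV_step by now apply reduced_smul.
    unfold state_mul; rewrite translate_translate; simpl.
    f_equal. destruct e; simpl; f_equal; lia.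
  - destruct h as [s [x y]]. unfold state_mul, push_step; simpl.
    rewrite <- step_translate, translate_translate. do 2 f_equal.
    destruct e; simpl; f_equal; lia.
Qed.

(** Replaying a reduced word from the identity never triggers a cancellation, so it rebuilds its own
    stack. *)
Lemma state_one_mul h : reduced (fst h) -> state_mul state_one h = h.
Proof.
  destruct h as [s v]; simpl. unfold state_mul; simpl. intros R.
  assert (E : smul state_one s = (s, (0, 0))).
  { clear v; induction s as [|[e t] s IH]; simpl; auto.
    destruct R as [R H]. rewrite (IH R).
    destruct s as [|[e' t'] s]; [destruct e; unfold step; simpl; state_eq|].
    destruct e, e'; unfold step, translate, push_step; simpl; auto;
      destruct H as [H|H]; try discriminate; apply Z.eqb_neq in H; now rewrite ?Z.add_0_l, ?H. }
  rewrite E. destruct v; reflexivity.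
Qed.

Lemma state_mulA g h k : reduced (fst g) ->
  state_mul g (state_mul h k) = state_mul (state_mul g h) k.
Proof.
  intros Rg. destruct k as [s v].
  change (state_mul g (translate v (smul h s)) = translate v (smul (state_mul g h) s)).
  rewrite state_mul_translate. f_equal. clear v.
  induction s as [|[e t] s IH]; simpl; auto.
  rewrite state_mul_step, state_mul_translate, IH; auto.
Qed.

Lemma smul_sdiv s : forall g, reduced (fst g) -> smul (sdiv g s) s = g.
Proof.
  induction s as [|[e t] s IH]; simpl; auto. intros g R.
  rewrite IH by (now apply reduced_step).
  rewrite translate_translate. transitivity (step e (step (negb e) g)).
  - f_equal. rewrite <- (translate0 (step (negb e) g)) at 2. f_equal.
    destruct e; simpl; f_equal; lia.
  - now apply stepV_step.
Qed.

Lemma state_invl g : state_mul (state_inv g) g = state_one.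
Proof.
  unfold state_mul, state_inv. rewrite smul_sdiv by exact I.
  rewrite translate_translate; simpl. unfold translate, state_one; simpl. state_eq.
Qed.

Lemma reduced_state_inv g : reduced (fst (state_inv g)).
Proof. apply reduced_sdiv. exact I. Qed.

(** * The group of reduced normal forms *)

Definition hnn_elt : Type := {g : state | reduced (fst g)}.

Lemma hnn_ext (g h : hnn_elt) : proj1_sig g = proj1_sig h -> g = h.
Proof.
  destruct g as [g Hg], h as [h Hh]; simpl; intros ->. f_equal. apply proof_irrelevance.
Qed.

Definition hnn_mul (g h : hnn_elt) : hnn_elt :=
  exist _ (state_mul (proj1_sig g) (proj1_sig h))
    (reduced_smul _ (fst (proj1_sig h)) (proj2_sig g)).
Definition hnn_inv (g : hnn_elt) : hnn_elt :=
  exist _ (state_inv (proj1_sig g)) (reduced_state_inv (proj1_sig g)).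
Definition hnn_one : hnn_elt := exist _ state_one I.

Definition hnn : group.
Proof.
  refine (@Group hnn_elt hnn_mul hnn_inv hnn_one _ _ _).
  - intros x y z. apply hnn_ext, state_mulA; apply proj2_sig.
  - intros x. apply hnn_ext, state_one_mul, proj2_sig.
  - intros x. apply hnn_ext, state_invl.
Defined.

Arguments gmul : simpl never.
Arguments ginv : simpl never.

Definition val (g : hnn) : state := proj1_sig g.

Lemma val_reduced (g : hnn) : reduced (fst (val g)).
Proof. apply (proj2_sig g). Qed.

Definition ga : hnn := exist _ ((true, 0) :: nil, (0, 0)) (conj I I).
Definition bc (v : Z * Z) : hnn := exist _ (nil, v) I.

Lemma val_mul_bc (g : hnn) v : val (gmul g (bc v)) = translate v (val g).
Proof. reflexivity. Qed.

Lemma val_mul_ga (g : hnn) : val (gmul g ga) = step true (val g).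
Proof.
  change (translate (0, 0) (step true (translate (0, 0) (val g))) = step true (val g)).
  now rewrite !translate0.
Qed.

Lemma val_mul_gaV (g : hnn) : val (gmul g (ginv ga)) = step false (val g).
Proof.
  rewrite <- (step_stepV true (val (gmul g (ginv ga)))) by apply val_reduced.
  rewrite <- val_mul_ga. now rewrite gmulKV.
Qed.

Lemma bc_mul v w : gmul (bc v) (bc w) = bc (fst v + fst w, snd v + snd w).
Proof. now apply hnn_ext. Qed.

Lemma bc0 : bc (0, 0) = gone.
Proof. now apply hnn_ext. Qed.

Lemma bc_inv v : ginv (bc v) = bc (- fst v, - snd v).
Proof. apply ginv_unique. rewrite bc_mul, <- bc0. simpl. do 2 f_equal; lia. Qed.

Lemma c_ga q : gmul (bc (0, q)) ga = gmul ga (bc (q, 0)).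
Proof.
  apply hnn_ext. change (val (gmul (bc (0, q)) ga) = val (gmul ga (bc (q, 0)))).
  now rewrite val_mul_ga, val_mul_bc.
Qed.

(** * Lipschitz functions and the projection to the axis *)

Definition sgn (e : bool) : Z := if e then 1 else -1.

Fixpoint slevel (s : stack) : Z :=
  match s with nil => 0 | (e, _) :: s' => slevel s' + sgn e end.

Fixpoint stotal (s : stack) : Z :=
  match s with nil => 0 | (_, t) :: s' => stotal s' + t end.

(** With [b_i = a^i b a^-i], so that [c = b_1], [lamp j] is the exponent sum of [b_j]. *)
Definition lamp_offset (e : bool) : Z := if e then 0 else 1.

Fixpoint slamp (j : Z) (s : stack) : Z :=
  match s with
  | nil => 0
  | (e, t) :: s' => slamp j s' + if j =? slevel s' + lamp_offset e then t else 0
  end.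

Definition axial (s : stack) : bool := forallb (fun p => snd p =? 0) s.

(** Position on the axis of [a] in the Bass-Serre tree of the projection of a vertex. *)
Fixpoint sproj (s : stack) : Z :=
  match s with
  | nil => 0
  | (e, t) :: s' => if axial ((e, t) :: s') then sproj s' + sgn e else sproj s'
  end.

Definition level (g : state) : Z := slevel (fst g).
Definition total (g : state) : Z := stotal (fst g) + fst (snd g) + snd (snd g).
Definition lamp (j : Z) (g : state) : Z :=
  slamp j (fst g) + (if j =? level g then fst (snd g) else 0)
                  + (if j =? level g + 1 then snd (snd g) else 0).
Definition proj (g : hnn) : Z := sproj (fst (val g)).

Lemma level_step e g : level (step e g) = level g + sgn e.
Proof.
  unfold level. destruct (step_cases e g) as [(t & s & E & F & ->)|[-> _]]; [rewrite E|];
    destruct e; simpl; lia.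
Qed.

Lemma total_step e g : total (step e g) = total g.
Proof.
  unfold total. destruct (step_cases e g) as [(t & s & E & F & ->)|[-> _]]; [rewrite E|];
    destruct e; simpl in *; lia.
Qed.

(** A [c] at level [i] and a [b] at level [i + 1] feed the same lamp, so moving one across [a]
    changes nothing. This is the map to the wreath product of [Z] with [Z]. *)
Lemma lamp_step j e g : lamp j (step e g) = lamp j g.
Proof.
  unfold lamp, level. destruct (step_cases e g) as [(t & s & E & F & ->)|[-> _]]; [rewrite E|];
    destruct e; simpl in *; rewrite ?F;
    repeat match goal with |- context [?x =? ?y] => destruct (Z.eqb_spec x y) end; lia.
Qed.

(** At a given level the two coordinates feed different lamps, so their changes do not add up. *)
Lemma lamp_translate j v g : Z.abs (fst v) <= 2 -> Z.abs (snd v) <= 2 ->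
  Z.abs (lamp j (translate v g)) <= Z.abs (lamp j g) + 2 /\
  Z.abs (lamp j g) <= Z.abs (lamp j (translate v g)) + 2.
Proof.
  intros H1 H2. unfold lamp, level, translate; simpl.
  repeat match goal with |- context [?x =? ?y] => destruct (Z.eqb_spec x y) end; lia.
Qed.

Lemma axial_slamp j s : axial s = true -> slamp j s = 0.
Proof.
  induction s as [|[e t] s IH]; simpl; auto.
  rewrite andb_true_iff, Z.eqb_eq. intros [-> H]. rewrite IH by easy. now destruct (_ =? _).
Qed.

Lemma axial_sproj s : axial s = true -> sproj s = slevel s.
Proof.
  induction s as [|[e t] s IH]; simpl; auto.
  intros H. rewrite H. apply andb_true_iff in H. now rewrite IH by apply H.
Qed.

Lemma axial_lamp j g : axial (fst g) = true ->
  lamp j g = (if j =? sproj (fst g) then fst (snd g) else 0)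
             + (if j =? sproj (fst g) + 1 then snd (snd g) else 0).
Proof. intros H. unfold lamp, level. rewrite axial_slamp, axial_sproj by easy. lia. Qed.

(** The projection moves only along an edge of the axis. Such an edge is crossed forwards from some
    [a^j c^q] to [a^(j+1) b^q], and backwards from some [a^j b^q] to [a^(j-1) c^q]: one exponent
    must be zero before the crossing, the other is zero after it. *)
Lemma sproj_step e g :
  sproj (fst (step e g)) = sproj (fst g) \/
  axial (fst g) = true /\ axial (fst (step e g)) = true /\
  sproj (fst (step e g)) = sproj (fst g) + sgn e /\
  exists q, snd g = swap_if_neg e (0, q) /\ snd (step e g) = swap_if_neg e (q, 0).
Proof.
  destruct (step_cases e g) as [(t & s & E & F & ->)|[-> _]].
  - rewrite E; simpl. destruct (Z.eqb_spec t 0) as [->|]; simpl; auto.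
    fold (axial s). destruct (axial s) eqn:Hs; auto. right. repeat split; auto.
    + destruct e; simpl; lia.
    + exists (snd (swap_if_neg e (snd g))). split; [|easy].
      destruct g as [? []], e; simpl in *; now subst.
  - simpl. fold (axial (fst g)). destruct (Z.eqb_spec (fst (swap_if_neg e (snd g))) 0) as [F|];
      simpl; auto.
    destruct (axial (fst g)) eqn:Hs; auto. right. repeat split; auto.
    exists (snd (swap_if_neg e (snd g))). split; [|easy].
    destruct g as [? []], e; simpl in *; now subst.
Qed.

(** * Elements over the axis and powers of [a] *)

Definition gpow (e : bool) : hnn := if e then ga else ginv ga.

Lemma val_mul_gpow g e : val (gmul g (gpow e)) = step e (val g).
Proof. destruct e; [apply val_mul_ga|apply val_mul_gaV]. Qed.

Lemma zpow_gpow n e : gmul (zpow ga n) (gpow e) = zpow ga (n + sgn e).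
Proof. destruct e; symmetry; [exact (zpow_succ ga n)|exact (zpow_pred ga n)]. Qed.

(** When all exponents vanish, reducedness forces all letters to have the same sign, so none
    cancels. *)
Lemma axial_zpow s : axial s = true -> forall g, val g = (s, (0, 0)) -> g = zpow ga (slevel s).
Proof.
  induction s as [|[e t] s IH]; simpl; intros H g E.
  - now apply hnn_ext.
  - apply andb_true_iff in H. destruct H as [H0 H]. apply Z.eqb_eq in H0; subst t.
    pose proof (val_reduced g) as R. rewrite E in R. simpl in R. destruct R as [R R'].
    rewrite <- zpow_gpow, <- (IH H (exist _ (s, (0, 0)) R) eq_refl).
    apply hnn_ext. fold (val g). fold (val (gmul (exist _ (s, (0, 0)) R : hnn) (gpow e))).
    rewrite E, val_mul_gpow. simpl.
    destruct s as [|[e' t'] s]; [destruct e; reflexivity|].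
    destruct R' as [<-|]; [|lia]. destruct e; reflexivity.
Qed.

Lemma axial_elt g : axial (fst (val g)) = true -> g = gmul (zpow ga (proj g)) (bc (snd (val g))).
Proof.
  intros H. unfold proj. rewrite axial_sproj by easy.
  rewrite <- (axial_zpow _ H (exist _ (fst (val g), (0, 0)) (val_reduced g)) eq_refl).
  apply hnn_ext. change (val g = translate (snd (val g)) (fst (val g), (0, 0))).
  destruct (val g) as [s [x y]]; reflexivity.
Qed.

Lemma val_zpow n : exists e k, val (zpow ga n) = (repeat (e, 0) k, (0, 0)).
Proof.
  destruct (Z_lt_le_dec n 0) as [H|H].
  - replace n with (- Z.of_nat (Z.to_nat (- n))) by lia.
    rewrite zpow_opp_of_nat. exists false, (Z.to_nat (- n)). generalize (Z.to_nat (- n)) as k.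
    induction k as [|k IH]; [exact (f_equal val ginv1)|].
    rewrite ginv_npowS, val_mul_gaV, IH. destruct k; reflexivity.
  - replace n with (Z.of_nat (Z.to_nat n)) by lia.
    rewrite zpow_of_nat. exists true, (Z.to_nat n). generalize (Z.to_nat n) as k.
    induction k as [|k IH]; [easy|].
    change (npow ga (S k)) with (gmul (npow ga k) ga).
    rewrite val_mul_ga, IH. destruct k; reflexivity.
Qed.

Lemma axial_repeat e k : axial (repeat (e, 0) k) = true.
Proof. induction k; auto. Qed.

Lemma level_zpow n : level (val (zpow ga n)) = n.
Proof.
  assert (Hk : forall k, level (val (zpow ga (Z.of_nat k))) = Z.of_nat k /\
                         level (val (zpow ga (- Z.of_nat k))) = - Z.of_nat k).
  { induction k as [|k [IH1 IH2]]; [easy|].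
    replace (Z.of_nat (S k)) with (Z.of_nat k + 1) by lia.
    replace (- (Z.of_nat k + 1)) with (- Z.of_nat k - 1) by lia.
    rewrite zpow_succ, zpow_pred, val_mul_ga, val_mul_gaV, !level_step, IH1, IH2. simpl. lia. }
  destruct (Z_lt_le_dec n 0).
  - replace n with (- Z.of_nat (Z.to_nat (- n))) by lia. apply Hk.
  - replace n with (Z.of_nat (Z.to_nat n)) by lia. apply Hk.
Qed.

Lemma total_zpow n : total (val (zpow ga n)) = 0.
Proof.
  destruct (val_zpow n) as (e & k & ->). unfold total; simpl.
  induction k; simpl; lia.
Qed.

Lemma proj_zpow n : proj (zpow ga n) = n.
Proof.
  rewrite <- (level_zpow n) at 2. unfold proj, level. apply axial_sproj.
  destruct (val_zpow n) as (e & k & ->). apply axial_repeat.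
Qed.

(** * The two generating sets *)

Definition gens : list hnn := ga :: bc (1, 0) :: bc (2, -1) :: nil.
Definition gens' : list hnn := gens ++ bc (0, 1) :: bc (2, 0) :: bc (0, 2) :: nil.

Lemma wlen_bc_multiple (A : list hnn) x y z : In (bc (x, y)) A ->
  wlen A (Z.abs_nat z) (bc (z * x, z * y)).
Proof.
  intros H. assert (Hk : forall k, wlen A k (bc (Z.of_nat k * x, Z.of_nat k * y)) /\
                                   wlen A k (bc (- Z.of_nat k * x, - Z.of_nat k * y))).
  { induction k as [|k [IH1 IH2]].
    - change (wlen A 0 (bc (0, 0)) /\ wlen A 0 (bc (0, 0))). rewrite bc0. split; constructor.
    - split.
      + eapply wlenR in IH1; [|exact H]. rewrite bc_mul in IH1. simpl fst in IH1; simpl snd in IH1.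
        replace (Z.of_nat (S k) * x) with (Z.of_nat k * x + x) by lia.
        now replace (Z.of_nat (S k) * y) with (Z.of_nat k * y + y) by lia.
      + eapply wlenRV in IH2; [|exact H]. rewrite bc_inv, bc_mul in IH2.
        simpl fst in IH2; simpl snd in IH2.
        replace (- Z.of_nat (S k) * x) with (- Z.of_nat k * x + - x) by lia.
        now replace (- Z.of_nat (S k) * y) with (- Z.of_nat k * y + - y) by lia. }
  destruct (Z_lt_le_dec z 0).
  - replace z with (- Z.of_nat (Z.abs_nat z)) at 2 3 by lia. apply Hk.
  - replace z with (Z.of_nat (Z.abs_nat z)) at 2 3 by lia. apply Hk.
Qed.

Lemma gens_incl : incl gens gens'.
Proof. apply incl_appl, incl_refl. Qed.

Lemma gens_generates : generates gens.
Proof.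
  assert (Hbc : forall v, exists n, wlen gens n (bc v)).
  { intros [x y]. exists (Z.abs_nat (- y) + Z.abs_nat (x + 2 * y))%nat.
    replace (bc (x, y)) with (gmul (bc (- y * 2, - y * -1)) (bc ((x + 2 * y) * 1, (x + 2 * y) * 0)))
      by (rewrite bc_mul; cbn [fst snd]; do 2 f_equal; lia).
    apply wlen_app; apply wlen_bc_multiple; simpl; auto. }
  assert (Hs : forall s, exists n w, wlen gens n w /\ val w = smul state_one s).
  { induction s as [|[e t] s (n & w & Hw & E)].
    - exists 0%nat, gone. split; [constructor|easy].
    - destruct (Hbc (swap_if_neg e (t, 0))) as [m Hm].
      exists (n + m + 1)%nat, (gmul (gmul w (bc (swap_if_neg e (t, 0)))) (gpow e)). split.
      + repeat apply wlen_app; auto.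
        destruct e; [apply wlen_gen|apply wlen_ginv_gen]; simpl; auto.
      + now rewrite val_mul_gpow, val_mul_bc, E. }
  intros g. destruct (Hs (fst (val g))) as (n & w & Hw & E), (Hbc (snd (val g))) as [m Hm].
  exists (n + m)%nat. replace g with (gmul w (bc (snd (val g)))); [now apply wlen_app|].
  apply hnn_ext. change (translate (snd (val g)) (val w) = val g). rewrite E.
  apply state_one_mul, val_reduced.
Qed.

Lemma gens'_generates : generates gens'.
Proof.
  intros g. destruct (gens_generates g) as [n Hn]. exists n.
  apply (wlen_incl gens); [apply gens_incl|easy].
Qed.

(** Level and total exponent are the coordinates of the abelianization, and each generator changes
    exactly one of them, by one. *)
Lemma gens_lipschitz u n w : wlen gens n w ->
  Z.abs (level (val (gmul u w)) - level (val u)) + Z.abs (total (val (gmul u w)) - total (val u))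
    <= Z.of_nat n.
Proof.
  intros H; induction H as [|n w s Hs _ IH|n w s Hs _ IH].
  - rewrite gmul1r. lia.
  - rewrite gmulA. simpl in Hs. destruct Hs as [<-|[<-|[<-|[]]]];
      rewrite ?val_mul_ga, ?val_mul_bc, ?level_step, ?total_step;
      unfold level, total, translate in *; simpl in *; lia.
  - rewrite gmulA. simpl in Hs. destruct Hs as [<-|[<-|[<-|[]]]]; rewrite ?bc_inv;
      rewrite ?val_mul_gaV, ?val_mul_bc, ?level_step, ?total_step;
      unfold level, total, translate in *; simpl in *; lia.
Qed.

(** Induction along paths from [u], with all generators other than [a] treated alike. The case of
    [a] keeps the word travelled so far, which bounds distances from [u]. *)
Lemma gens'_move_ind (Q : nat -> hnn -> Prop) (u : hnn) :
  Q 0%nat u ->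
  (forall n v e, Q n v -> wlen gens' (S n) (gmul (ginv u) (gmul v (gpow e))) ->
     Q (S n) (gmul v (gpow e))) ->
  (forall n v d, Q n v -> Z.abs (fst d) <= 2 -> Z.abs (snd d) <= 2 ->
     Q (S n) (gmul v (bc d))) ->
  forall n w, wlen gens' n w -> Q n (gmul u w).
Proof.
  intros Q0 Qa Qbc n w H; induction H as [|n w s Hs Hw IH|n w s Hs Hw IH].
  - now rewrite gmul1r.
  - rewrite gmulA. simpl in Hs.
    destruct Hs as [<-|[<-|[<-|[<-|[<-|[<-|[]]]]]]]; try (apply Qbc; simpl; auto; lia).
    apply (Qa n _ true); auto. rewrite <- gmulA, gmulVK. apply wlenR; simpl; auto.
  - rewrite gmulA. simpl in Hs.
    destruct Hs as [<-|[<-|[<-|[<-|[<-|[<-|[]]]]]]];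
      try (rewrite bc_inv; apply Qbc; simpl; auto; lia).
    apply (Qa n _ false); auto. rewrite <- gmulA, gmulVK. apply wlenRV; simpl; auto.
Qed.

Lemma gens'_level_lipschitz u n w : wlen gens' n w ->
  Z.abs (level (val (gmul u w)) - level (val u)) <= Z.of_nat n.
Proof.
  revert n w.
  apply (gens'_move_ind (fun n v => Z.abs (level (val v) - level (val u)) <= Z.of_nat n)).
  - lia.
  - intros n v e IH _. rewrite val_mul_gpow, level_step. destruct e; simpl sgn; lia.
  - intros n v d IH _ _. rewrite val_mul_bc. unfold level, translate in *; simpl in *; lia.
Qed.

Lemma wlen_zpow (A : list hnn) n : In ga A -> wlen A (Z.abs_nat n) (zpow ga n).
Proof.
  intros Ha. destruct (Z_lt_le_dec n 0) as [H|H].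
  - replace n with (- Z.of_nat (Z.abs_nat n)) at 2 by lia. rewrite zpow_opp_of_nat.
    induction (Z.abs_nat n) as [|k IH]; [change (npow ga 0) with (@gone hnn); rewrite ginv1; constructor|].
    rewrite ginv_npowS. now apply wlenRV.
  - replace n with (Z.of_nat (Z.abs_nat n)) at 2 by lia. rewrite zpow_of_nat.
    induction (Z.abs_nat n) as [|k IH]; [constructor|]. now apply wlenR.
Qed.

(** The word [a^(n-m)] gives the upper bound and the Lipschitz level the lower one. This serves both
    generating sets. *)
Lemma wdist_zpow (A : list hnn) m n : In ga A -> incl A gens' ->
  INR (wdist A (zpow ga m) (zpow ga n)) = Rabs (IZR m - IZR n).
Proof.
  intros Ha HA. rewrite <- minus_IZR, <- abs_IZR, INR_IZR_INZ. f_equal.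
  assert (E : gmul (ginv (zpow ga m)) (zpow ga n) = zpow ga (n - m)).
  { rewrite <- (gmulVK (zpow ga m) (zpow ga (n - m))), zpow_add. do 2 f_equal; lia. }
  destruct (wdist_min A (zpow ga m) (zpow ga n) (Z.abs_nat (n - m))) as [H1 H2].
  { rewrite E. now apply wlen_zpow. }
  apply (wlen_incl A gens') in H1; auto.
  apply (gens'_level_lipschitz (zpow ga m)) in H1.
  rewrite gmulKl, !level_zpow in H1. lia.
Qed.

Lemma wlen_gens'_coord e y : exists m,
  wlen gens' m (bc (swap_if_neg e (y, 0))) /\ 2 * Z.of_nat m <= Z.abs y + 1.
Proof.
  (* As many squares as possible, then at most one single letter. Truncated division gives the
     remainder the sign of [y], so the total is [|y|/2] rounded up. *)
  exists (Z.abs_nat (Z.quot y 2) + Z.abs_nat (Z.rem y 2))%nat.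
  pose proof (Z.quot_rem' y 2) as E. split; [|Z.to_euclidean_division_equations; lia].
  destruct e.
  - replace (bc (swap_if_neg true (y, 0))) with
      (gmul (bc (Z.quot y 2 * 2, Z.quot y 2 * 0)) (bc (Z.rem y 2 * 1, Z.rem y 2 * 0)))
      by (rewrite bc_mul; cbn [fst snd swap_if_neg]; do 2 f_equal; lia).
    apply wlen_app; apply wlen_bc_multiple; simpl; tauto.
  - replace (bc (swap_if_neg false (y, 0))) with
      (gmul (bc (Z.quot y 2 * 0, Z.quot y 2 * 2)) (bc (Z.rem y 2 * 0, Z.rem y 2 * 1)))
      by (rewrite bc_mul; cbn [fst snd swap_if_neg]; do 2 f_equal; lia).
    apply wlen_app; apply wlen_bc_multiple; simpl; tauto.
Qed.

(** A path whose projection advances in direction [e] enters over [a^j] at some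
    [a^j b^y] (or [a^j c^y]) and can only leave forwards after its lamp, initially [y],
    has been extinguished, which takes as long as walking to [a^j]. *)
Lemma crossing_cost e u n w :
  let j := proj u + sgn e in
  let D := Z.of_nat (wdist gens' u (zpow ga j)) in
  let k := sgn e * (proj (gmul u w) - proj u) in
  wlen gens' n w ->
  (k = 1 -> 2 * D <= 2 * Z.of_nat n + Z.abs (lamp (j + lamp_offset e) (val (gmul u w))) + 1) /\
  (2 <= k -> D + k - 1 <= Z.of_nat n).
Proof.
  intros j D k; subst k. revert n w.
  apply (gens'_move_ind (fun n v =>
    let k := sgn e * (proj v - proj u) in
    (k = 1 -> 2 * D <= 2 * Z.of_nat n + Z.abs (lamp (j + lamp_offset e) (val v)) + 1) /\
    (2 <= k -> D + k - 1 <= Z.of_nat n))); cbv zeta.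
  - lia.
  - intros n v e' [IH1 IH2] Hw.
    set (v' := gmul v (gpow e')) in *.
    assert (Ev : val v' = step e' (val v)) by apply val_mul_gpow.
    destruct (sproj_step e' (val v)) as [E|(A & A' & E & q & F & F')];
      rewrite <- Ev in *; change (sproj (fst (val v'))) with (proj v') in E;
      change (sproj (fst (val v))) with (proj v) in E.
    + rewrite Ev, lamp_step, E. lia.
    + rewrite E in *. destruct (Bool.bool_dec e' e) as [->|Ne].
      * replace (sgn e * (proj v + sgn e - proj u)) with (sgn e * (proj v - proj u) + 1)
          by (destruct e; unfold sgn; lia).
        split; intros Hk.
        -- assert (Hj : proj v' = j) by (unfold j; destruct e; unfold sgn in *; lia).
           rewrite axial_lamp, F' by easy.
           change (sproj (fst (val v'))) with (proj v'). rewrite Hj.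
           (* Entering over [a^j] with exponent [q]: erasing it leads to [a^j], so [D] is at most
              [n + 1] plus [|q|/2] rounded up, and [q] is the value of the lamp. *)
           destruct (wlen_gens'_coord e (- q)) as (m & Hm & Hm').
           assert (HD : D <= Z.of_nat (S n + m)).
           { apply Nat2Z.inj_le, wdist_le.
             replace (zpow ga j) with (gmul v' (bc (swap_if_neg e (- q, 0)))).
             - rewrite gmulA. now apply wlen_app.
             - rewrite (axial_elt v' A'), Hj, F', <- gmulA, bc_mul.
               replace (bc _) with (@gone hnn); [apply gmul1r|].
               rewrite <- bc0. destruct e; simpl; do 2 f_equal; lia. }
           match goal with |- context [Z.abs ?z] => replace z with q end; [lia|].
           destruct e; simpl;
             repeat match goal with |- context [?x =? ?y] => destruct (Z.eqb_spec x y) end; lia.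
        (* Leaving [a^j] forwards forces the lamp to be zero, so [2 D <= 2 n + 1] and, by
           integrality, [D <= n]. Farther along, both sides grow by one. *)
        -- destruct (Z.eq_dec (sgn e * (proj v - proj u)) 1) as [H1|]; [|lia].
           specialize (IH1 H1).
           assert (Hj : proj v = j) by (unfold j; destruct e; unfold sgn in *; lia).
           rewrite axial_lamp, F in IH1 by easy.
           change (sproj (fst (val v))) with (proj v) in IH1. rewrite Hj in IH1.
           destruct e; cbn [fst snd swap_if_neg lamp_offset] in IH1; revert IH1;
             repeat match goal with |- context [?x =? ?y] => destruct (Z.eqb_spec x y) end; lia.
      (* Coming back to [a^j] from beyond, the bound [D + 1 <= n] is already more than enough. *)
      * assert (Hs : sgn e' = - sgn e) by (destruct e, e'; unfold sgn; congruence || lia).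
        rewrite Hs.
        replace (sgn e * (proj v + - sgn e - proj u)) with (sgn e * (proj v - proj u) - 1)
          by (destruct e; unfold sgn; lia).
        lia.
  - intros n v d [IH1 IH2] H1 H2.
    change (proj (gmul v (bc d))) with (proj v). rewrite val_mul_bc.
    (* The lamp loses at most two, which the extra letter repays in [2 n]. *)
    pose proof (lamp_translate (j + lamp_offset e) d (val v) H1 H2). lia.
Qed.

Lemma far_projection u v : 2 <= Z.abs (proj u - proj v) ->
  exists i, (wdist gens' u (zpow ga i) < wdist gens' u v)%nat.
Proof.
  intros H.
  assert (He : exists e, 2 <= sgn e * (proj v - proj u)).
  { destruct (Z_le_gt_dec (proj u) (proj v)); [exists true|exists false]; unfold sgn; lia. }
  destruct He as [e He]. exists (proj u + sgn e).
  pose proof (crossing_cost e u _ _ (wdist_wlen gens' u v gens'_generates)) as [_ C].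
  rewrite gmulKl in C. specialize (C He). lia.
Qed.

Local Open Scope R_scope.

(** * Strong contraction for the larger generating set *)

Definition point_proj (p : cpt hnn) : Z :=
  match p with Vx g => proj g | Ed g _ _ => proj g end.

Lemma proj_gen g s : In s gens' -> (Z.abs (proj (gmul g s) - proj g) <= 1)%Z.
Proof.
  intros Hs. simpl in Hs.
  destruct Hs as [<-|[<-|[<-|[<-|[<-|[<-|[]]]]]]];
    try (change (proj (gmul g (bc ?v))) with (proj g); rewrite Z.sub_diag; easy).
  unfold proj. rewrite val_mul_ga.
  destruct (sproj_step true (val g)) as [->|(_ & _ & -> & _)]; simpl sgn; lia.
Qed.

Lemma point_proj_ends p u r : valid gens' p -> In (u, r) (ends p) ->
  (Z.abs (proj u - point_proj p) <= 1)%Z.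
Proof.
  destruct p as [g|g s t]; intros V H.
  - destruct H as [[= <- <-]|[]]. simpl. lia.
  - destruct H as [[= <- <-]|[[= <- <-]|[]]]; simpl; [lia|]. now apply proj_gen, V.
Qed.

(** If the distance runs through ends [u] and [v] whose projections differ by two or more, the axis
    is strictly nearer to [x] than [x'] is. Otherwise the error is one for [u] and [v] and one for
    each end. *)
Lemma point_proj_close x x' : valid gens' x -> valid gens' x' ->
  (forall y, image (gamma gone ga) y -> gdist gens' x x' <= gdist gens' x y) ->
  (Z.abs (point_proj x - point_proj x') <= 3)%Z.
Proof.
  intros V V' H.
  destruct (gdist_attained gens' x x') as [(u & r & v & r' & Hu & Hv & E)|(u & r & r' & Hu & Hv)].
  - pose proof (point_proj_ends _ _ _ V Hu). pose proof (point_proj_ends _ _ _ V' Hv).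
    destruct (Z_le_gt_dec 2 (Z.abs (proj u - proj v))) as [Hf|]; [|lia].
    destruct (far_projection u v Hf) as [i Hi]. apply lt_INR in Hi.
    assert (Hy : image (gamma gone ga) (Vx (zpow ga i)))
      by (exists (IZR i); now rewrite gamma_vertex).
    specialize (H _ Hy).
    pose proof (gdist_le gens' x (Vx (zpow ga i)) u r _ 0 Hu (or_introl eq_refl)).
    pose proof (ends_weight_bounds gens' x' v r' V' Hv). lra.
  - pose proof (point_proj_ends _ _ _ V Hu). pose proof (point_proj_ends _ _ _ V' Hv). lia.
Qed.

Lemma point_proj_gamma t : IZR (point_proj (gamma gone ga t)) <= t < IZR (point_proj (gamma gone ga t)) + 1.
Proof.
  destruct (gamma_cases ga t) as (n & r & -> & [[-> ->]|[Hr ->]]); simpl; rewrite proj_zpow; lra.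
Qed.

Lemma gens_geodesic : is_geodesic gens (gamma gone ga).
Proof.
  apply gamma_is_geodesic; [now left|]. intros m n. apply wdist_zpow; [now left|apply gens_incl].
Qed.

Lemma gens'_geodesic : is_geodesic gens' (gamma gone ga).
Proof.
  apply gamma_is_geodesic; [now left|]. intros m n. apply wdist_zpow; [now left|apply incl_refl].
Qed.

Lemma gens'_strongly_contracting : strongly_contracting gens' (image (gamma gone ga)).
Proof.
  destruct gens'_geodesic as [Hv Hg].
  (* Three for each of the pairs [p] with its point, [x] with [x'], and [q] with its point, plus one
     for rounding parameters to integers. *)
  exists 10. intros x x' V V' H p q Hp Hq.
  pose proof (point_proj_close x x' V V' H) as Hx.
  assert (Hclose : forall p, cproj gens' (image (gamma gone ga)) x p \/
                             cproj gens' (image (gamma gone ga)) x' p ->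
            exists t, p = gamma gone ga t /\
              (Z.abs (point_proj x - point_proj p) <= 3 \/
               Z.abs (point_proj x' - point_proj p) <= 3)%Z).
  (* A closest point is itself no farther than the axis, so the same bound applies to it. *)
  { clear p q Hp Hq. intros p [[[t ->] Hm]|[[t ->] Hm]]; exists t; split; auto;
      [left|right]; apply point_proj_close; auto. }
  destruct (Hclose p Hp) as (t & -> & Ht), (Hclose q Hq) as (t' & -> & Ht').
  rewrite Hg. pose proof (point_proj_gamma t). pose proof (point_proj_gamma t').
  assert (Hd : (-9 <= point_proj (gamma gone ga t) - point_proj (gamma gone ga t') <= 9)%Z) by lia.
  destruct Hd as [Hd1 Hd2]. apply IZR_le in Hd1, Hd2. rewrite minus_IZR in Hd1, Hd2.
  unfold Rabs; destruct Rcase_abs; lra.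
Qed.

(** * Failure of strong contraction for the smaller generating set *)

(** Each step along the axis halves the exponent of [b], while the distance to the axis
    decreases at unit speed. *)
Lemma halving_path k r :
  wlen gens (2 ^ k * r - r + k)
    (gmul (bc (- Z.of_nat (2 ^ k * r), 0)%Z)
       (gmul (zpow ga (Z.of_nat k)) (bc (Z.of_nat r, 0%Z)))).
Proof.
  induction k as [|k IH].
  - replace (2 ^ 0 * r - r + 0)%nat with 0%nat by (simpl; lia).
    change (zpow ga (Z.of_nat 0)) with (@gone hnn). rewrite gmul1, bc_mul. cbn [fst snd].
    replace (bc _) with (@gone hnn); [constructor|].
    rewrite <- bc0. do 2 f_equal. simpl. lia.
  - set (R := (2 ^ k * r)%nat) in *.
    assert (HR : (r <= R)%nat) by (unfold R; pose proof (Nat.pow_nonzero 2 k); nia).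
    replace (2 ^ S k * r)%nat with (2 * R)%nat by (unfold R; simpl; lia).
    replace (2 * R - r + S k)%nat with ((R + 1) + (R - r + k))%nat by lia.
    (* Since [(b^2 c^-1)^(-R) a = b^(-2R) c^R a = b^(-2R) a b^R], the new factor [b^R] cancels the
       leading [b^(-R)] of the shorter path, at a cost of [R + 1] letters. *)
    replace (gmul _ _) with
      (gmul (gmul (bc (- Z.of_nat R * 2, - Z.of_nat R * -1)%Z) ga)
        (gmul (bc (- Z.of_nat R, 0)%Z) (gmul (zpow ga (Z.of_nat k)) (bc (Z.of_nat r, 0%Z))))).
    + apply wlen_app; [|easy]. apply wlen_app; [|apply wlen_gen; now left].
      replace R with (Z.abs_nat (- Z.of_nat R)) at 1 by lia.
      apply wlen_bc_multiple. simpl; auto.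
    + replace (zpow ga (Z.of_nat (S k))) with (gmul ga (zpow ga (Z.of_nat k)))
        by now rewrite !zpow_of_nat, npow_comm.
      rewrite !gmulA. do 2 f_equal.
      replace (bc (- Z.of_nat R * 2, - Z.of_nat R * -1)%Z) with
        (gmul (bc (- Z.of_nat (2 * R), 0)%Z) (bc (0, Z.of_nat R)%Z))
        by (rewrite bc_mul; cbn [fst snd]; do 2 f_equal; lia).
      rewrite <- !gmulA. f_equal. rewrite gmulA, c_ga, <- gmulA, bc_mul. cbn [fst snd].
      replace (bc _) with (@gone hnn); [apply gmul1r|].
      rewrite <- bc0. do 2 f_equal; lia.
Qed.

(** The total exponent vanishes at the vertices of the axis and changes by at most one per
    letter. *)
Lemma axis_lower_bound u y : image (gamma gone ga) y ->
  IZR (Z.abs (total (val u))) <= gdist gens (Vx u) y.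
Proof.
  intros [t ->].
  assert (Hd : forall i, IZR (Z.abs (total (val u))) <= INR (wdist gens u (zpow ga i))).
  { intros i. rewrite INR_IZR_INZ. apply IZR_le.
    pose proof (gens_lipschitz u _ _ (wdist_wlen gens u (zpow ga i) gens_generates)) as H.
    rewrite gmulKl, total_zpow in H. lia. }
  destruct (gamma_cases ga t) as (n & r & -> & [[-> ->]|[Hr ->]]).
  - rewrite gdist_vertices. apply Hd.
  - unfold gdist, through_ends; simpl. rewrite <- zpow_succ.
    pose proof (Hd n). pose proof (Hd (n + 1)%Z).
    unfold Rmin; destruct Rle_dec; lra.
Qed.

(** The word [b^r] attains the lower bound given by the total exponent. *)
Lemma cproj_zpow_b n r :
  cproj gens (image (gamma gone ga)) (Vx (gmul (zpow ga n) (bc (Z.of_nat r, 0%Z))))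
    (Vx (zpow ga n)).
Proof.
  split; [exists (IZR n); now rewrite gamma_vertex|]. intros y Hy.
  eapply Rle_trans; [|apply axis_lower_bound, Hy].
  rewrite gdist_vertices, INR_IZR_INZ. apply IZR_le.
  rewrite val_mul_bc.
  assert (E : total (translate (Z.of_nat r, 0%Z) (val (zpow ga n))) = Z.of_nat r).
  { pose proof (total_zpow n) as H. unfold total, translate in *; simpl in *. lia. }
  rewrite E, Z.abs_eq by lia. apply Nat2Z.inj_le, wdist_le.
  rewrite ginvM, gmulKV, bc_inv. cbn [fst snd].
  replace r with (Z.abs_nat (- Z.of_nat r)) at 1 by lia.
  replace (bc (- Z.of_nat r, - 0)%Z) with (bc (- Z.of_nat r * 1, - Z.of_nat r * 0)%Z)
    by (do 2 f_equal; lia).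
  apply wlen_bc_multiple. simpl; auto.
Qed.

Lemma gens_not_strongly_contracting : ~ strongly_contracting gens (image (gamma gone ga)).
Proof.
  intros [C HC].
  set (k := Z.abs_nat (up C)).
  assert (Hk : C < IZR (Z.of_nat k)).
  { apply Rlt_le_trans with (IZR (up C)); [apply archimed|]. apply IZR_le. lia. }
  (* With [r = k] the halving path has length [L - k + k = L], exactly the distance from [x] to the
     axis. *)
  set (L := (2 ^ k * k)%nat).
  set (x := gmul (zpow ga 0) (bc (Z.of_nat L, 0%Z))).
  set (x' := gmul (zpow ga (Z.of_nat k)) (bc (Z.of_nat k, 0%Z))).
  assert (H : gdist gens (Vx (zpow ga 0)) (Vx (zpow ga (Z.of_nat k))) <= C).
  { apply (HC (Vx x) (Vx x')); try exact I.
    - intros y Hy. eapply Rle_trans; [|apply axis_lower_bound, Hy].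
      rewrite gdist_vertices, INR_IZR_INZ. apply IZR_le.
      replace (total (val x)) with (Z.of_nat L) by (unfold x, total; simpl; lia).
      rewrite Z.abs_eq by lia. apply Nat2Z.inj_le.
      assert (HL : (k <= L)%nat) by (unfold L; pose proof (Nat.pow_nonzero 2 k); nia).
      replace L with (2 ^ k * k - k + k)%nat by (fold L; lia). apply wdist_le.
      replace (ginv x) with (bc (- Z.of_nat L, 0)%Z); [apply halving_path|].
      unfold x. change (zpow ga 0) with (@gone hnn). now rewrite gmul1, bc_inv.
    - left. apply cproj_zpow_b.
    - right. apply cproj_zpow_b. }
  rewrite gdist_vertices, wdist_zpow in H; [|now left|apply gens_incl].
  rewrite <- minus_IZR, <- abs_IZR in H.
  replace (Z.abs (0 - Z.of_nat k)) with (Z.of_nat k) in H by lia. lra.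
Qed.

Theorem theorem4 :
  exists (G : group) (S St : list G) (g0 a : G),
    incl S St /\ generates S /\ generates St /\ In a S /\
    is_geodesic S (gamma g0 a) /\
    ~ strongly_contracting S (image (gamma g0 a)) /\
    is_geodesic St (gamma g0 a) /\
    strongly_contracting St (image (gamma g0 a)).
Proof.
  exists hnn, gens, gens', gone, ga.
  repeat split.
  - apply gens_incl.
  - apply gens_generates.
  - apply gens'_generates.
  - now left.
  - apply gens_geodesic.
  - apply gens_geodesic.
  - apply gens_not_strongly_contracting.
  - apply gens'_geodesic.
  - apply gens'_geodesic.
  - apply gens'_strongly_contracting.
Qed.
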